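(* Let $u\in CBV[0,T]$, $y:=\mathcal S(u)$, and let $z\in\mathcal K^{\mathrm{red,crit}}_{G_r}(y,u)$ be given. Then there exist functions $z_{i,j},z_j\in G_r[0,T]$, $i,j\in\mathbb N$, such that: - $z_{i,j}\in\mathcal K^{\mathrm{rad,crit}}_{C^\infty}(y,u)$ and $\|z_{i,j}\|_\infty\le\|z\|_\infty$ for all $i,j$; - $z_j\in\mathcal K^{\mathrm{red,crit}}_{G_r}(y,u)$ and $\|z_j\|_\infty\le\|z\|_\infty$ for all $j$; - for every $j$, $z_{i,j}\to z_j$ pointwise in $[0,T]$ for $i\to\infty$; - $z_j\to z$ uniformly in $[0,T]$ for $j\to\infty$.
   Context: Fixed data: $T>0$, $r>0$, $Z=[-r,r]$, $y_0\in Z$. $C[0,T]$ and $G[0,T]$ are the real-valued continuous and regulated functions on $[0,T]$ (regulated = uniform limit of step functions), with the supremum norm $\|\cdot\|_\infty$. For $v\in G[0,T]$, $v(t-)$, $v(t+)$ are left and right limits, with $v(0-):=v(0)$, $v(T+):=v(T)$. $G_r[0,T]:=\{v\in G[0,T]:v(t)=v(t+)\ \forall t\in[0,T]\}$. $BV[0,T]$: real-valued functions of bounded variation; $CBV[0,T]:=BV[0,T]\cap C[0,T]$. $C^\infty[0,T]$: restrictions to $[0,T]$ of functions in $C^\infty(\mathbb R)$. $C([0,T];Z)$: continuous functions with values in $Z$. Integrals are Kurzweil–Stieltjes integrals (for continuous integrand and $BV$ integrator they coincide with Riemann–Stieltjes integrals). Scalar stop operator: $\mathcal S:CBV[0,T]\to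 CBV[0,T]$ maps $u$ to the (known to exist) unique $y\in CBV[0,T]$ with $\int_0^T(v-y)\,\mathrm d(y-u)\ge0$ for all $v\in C([0,T];Z)$, $y(t)\in Z$ for all $t$, and $y(0)=y_0$. For $u\in CBV[0,T]$, $y=\mathcal S(u)$: $I(y):=\{t\in[0,T]:|y(t)|<r\}$; $B_\pm(y,u):=\{t\in[0,T]: y(t)=\pm r$ and there is $\varepsilon>0$ such that $y-u$ is constant on $[t,t+\varepsilon)\}$, with the convention $T\in B_\pm(y,u)$ if $y(T)=\pm r$; $A(y,u):=\{t\in[0,T):|y(t)|=r$ and there is no $\varepsilon>0$ such that $y-u$ is constant on $[t,t+\varepsilon)\}$. $K^{\mathrm{ptw}}_{\mathrm{crit}}(y,u)(t):=\mathbb R$ if $t\in I(y)$, $(-\infty,0]$ if $t\in B_+(y,u)$, $[0,\infty)$ if $t\in B_-(y,u)$, $\{0\}$ if $t\in A(y,u)$. Reduced critical cone: $\mathcal K^{\mathrm{red,crit}}_{G_r}(y,u):=\{z\in G_r[0,T]: z(t)\in K^{\mathrm{ptw}}_{\mathrm{crit}}(y,u)(t)\ \forall t\in[0,T],\ z(0)=0,\ \text{and } z(t)=0\ \forall t\in[0,T]\text{ with }z(t-)\ne z(t)\}$. Cone of smooth critical radial directions: $\mathcal K^{\mathrm{rad,crit}}_{C^\infty}(y,u):=\{z\in C^\infty[0,T]: z(t)\in K^{\mathrm{ptw}}_{\mathrm{crit}}(y,u)(t)\ \forall t\in[0,T],\ z(0)=0,\ \text{and } \exists\alpha>0\text{ with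 } y(t)+\alpha z(t)\in Z\ \forall t\in[0,T]\}$. *)

(* Defs.v *)
From HB Require Import structures.
From mathcomp Require Import all_boot all_order all_algebra.
From mathcomp Require Import all_classical all_reals all_analysis.

Set Implicit Arguments.
Unset Strict Implicit.
Unset Printing Implicit Defensive.

Import Order.TTheory GRing.Theory Num.Theory.
Import numFieldNormedType.Exports.

Local Open Scope classical_set_scope.
Local Open Scope ring_scope.

(* A function on [0, T] is represented by a total function R -> R, of which
   only the values on `[0, T] matter: every notion below depends on these
   values only. *)

Definition supnorm (R : realType) (T : R) (v : R -> R) : R :=
  sup [set `|v t| | t in `[0, T]].

(* v(t-) and v(t+), with the conventions v(0-) = v(0) and v(T+) = v(T) *)
Definition left_limit (R : realType) (v : R -> R) (t : R) : R :=
  if 0 < t then lim (v x @[x --> t^'-]) else v t.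

Definition right_limit (R : realType) (T : R) (v : R -> R) (t : R) : R :=
  if t < T then lim (v x @[x --> t^'+]) else v t.

Definition step_function (R : realType) (T : R) (f : R -> R) : Prop :=
  exists2 s : seq R, itv_partition 0 T s &
    forall i, (i < size s)%N ->
      exists c, forall x, nth T (0 :: s) i < x < nth T s i -> f x = c.

Definition regulated (R : realType) (T : R) (v : R -> R) : Prop :=
  exists2 f : nat -> R -> R, forall n, step_function T (f n) &
    {uniform `[0, T], f @ \oo --> v}.

Definition Gr (R : realType) (T : R) : set (R -> R) :=
  [set v | regulated T v /\ forall t, 0 <= t <= T -> v t = right_limit T v t].

Definition CBV (R : realType) (T : R) : set (R -> R) :=
  [set v | bounded_variation 0 T v /\ {within `[0, T], continuous v}].

Definition Cinfty (R : realType) (T : R) : set (R -> R) :=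
  [set v | exists2 f : R -> R,
     forall n x, derivable (derive1n n f) x 1 & forall t, 0 <= t <= T -> v t = f t].

Definition Zset (R : realType) (r : R) : set R := `[- r, r].

Definition C_in_Z (R : realType) (T r : R) : set (R -> R) :=
  [set v | {within `[0, T], continuous v} /\
           forall t, 0 <= t <= T -> Zset r (v t)].

(* The division points are a :: s (the last of them being b) and the tag of the
   i-th subinterval is xi i. *)
Definition gauge_fine (R : realType) (a b : R) (delta : R -> R)
    (s : seq R) (xi : nat -> R) : Prop :=
  itv_partition a b s /\
  forall i, (i < size s)%N ->
    [/\ nth b (a :: s) i <= xi i <= nth b s i,
        xi i - delta (xi i) < nth b (a :: s) i
      & nth b s i < xi i + delta (xi i)].

Definition KS_sum (R : realType) (a b : R) (f g : R -> R)
    (s : seq R) (xi : nat -> R) : R :=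
  \sum_(i < size s) f (xi i) * (g (nth b s i) - g (nth b (a :: s) i)).

(* The Kurzweil-Stieltjes integral of f with respect to g over [a, b] exists
   and equals l. *)
Definition is_KS_integral (R : realType) (a b : R) (f g : R -> R) (l : R)
    : Prop :=
  forall e : R, 0 < e ->
    exists2 delta : R -> R, forall x, a <= x <= b -> 0 < delta x &
      forall s xi, gauge_fine a b delta s xi -> `|KS_sum a b f g s xi - l| < e.

(* y = S(u) for the scalar stop operator with initial value y0 *)
Definition is_stop (R : realType) (T r y0 : R) (u y : R -> R) : Prop :=
  [/\ CBV T y,
      forall v, C_in_Z T r v ->
        exists2 l, is_KS_integral 0 T (fun t => v t - y t)
                                      (fun t => y t - u t) l & 0 <= l,
      forall t, 0 <= t <= T -> Zset r (y t)
    & y 0 = y0].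

(* w is constant on [t, t + eps), as a function on [0, T], for some eps > 0 *)
Definition locally_constant_right (R : realType) (T : R) (w : R -> R) (t : R)
    : Prop :=
  exists2 eps : R, 0 < eps &
    forall s, t <= s < t + eps -> s <= T -> w s = w t.

Definition Iset (R : realType) (T r : R) (y : R -> R) : set R :=
  [set t | 0 <= t <= T /\ `|y t| < r].

(* c is r for B_+ and - r for B_- *)
Definition Bset (R : realType) (T c : R) (y u : R -> R) : set R :=
  [set t | [/\ 0 <= t <= T, y t = c &
    t = T \/ locally_constant_right T (fun s => y s - u s) t]].

Definition Aset (R : realType) (T r : R) (y u : R -> R) : set R :=
  [set t | [/\ 0 <= t < T, `|y t| = r &
    ~ locally_constant_right T (fun s => y s - u s) t]].

(* For r > 0 and y with values in [- r, r], the four cases partition [0, T]. *)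
Definition Kptw (R : realType) (T r : R) (y u : R -> R) (t : R) : set R :=
  if t \in Iset T r y then setT
  else if t \in Bset T r y u then [set x | x <= 0]
  else if t \in Bset T (- r) y u then [set x | 0 <= x]
  else if t \in Aset T r y u then [set 0]
  else set0.

Definition Kred_crit (R : realType) (T r : R) (y u : R -> R)
    : set (R -> R) :=
  [set z | [/\ Gr T z,
      forall t, 0 <= t <= T -> Kptw T r y u t (z t),
      z 0 = 0
    & forall t, 0 <= t <= T -> left_limit z t <> z t -> z t = 0]].

Definition Krad_crit (R : realType) (T r : R) (y u : R -> R)
    : set (R -> R) :=
  [set z | [/\ Cinfty T z,
      forall t, 0 <= t <= T -> Kptw T r y u t (z t),
      z 0 = 0
    & exists2 alpha : R, 0 < alpha &
        forall t, 0 <= t <= T -> Zset r (y t + alpha * z t)]].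

(* Main.v *)
Require Import Defs.
From HB Require Import structures.
From mathcomp Require Import all_boot all_order all_algebra.
From mathcomp Require Import all_classical all_reals all_analysis.
From mathcomp Require Import ring lra.

Set Implicit Arguments.
Unset Strict Implicit.
Unset Printing Implicit Defensive.

Import Order.TTheory GRing.Theory Num.Theory.
Import numFieldNormedType.Exports.

Local Open Scope classical_set_scope.
Local Open Scope ring_scope.

(** A critical direction [z] jumps only down to the value [0]: at a point where
    the left limit differs from the value, the value is [0].  Since [z] is also
    right-continuous, it is continuous at every point where it does not vanish
    ([Kred_crit_continuous]), so [{z > 0}] and [{z < 0}] are open in [[0, T]].
    This makes [z] itself a pointwise limit of smooth functions that vanish
    wherever [z] vanishes, and the family [zj] can be taken constantly equal to
    [z].

    The smooth functions sample [z] on a grid of mesh [h] and glue the samples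
    with a smooth partition of unity made of translates of one bump of width
    [h] ([hat_approx]).  A sample at [p] is kept only if [z] has the sign of
    [z p] on all of [[p - h, p + h]].  Thus each term of the sum is a multiple of
    a bump that lives in a compact interval on which [z] has that strict sign.

    - Where [z t <> 0], continuity ensures that for small [h] all samples near
      [t] are kept and close to [z t]; where [z t = 0], every term vanishes at
      [t].  This is pointwise convergence ([hat_approx_cvg]), and a convex
      combination of samples cannot exceed the supremum norm of [z].
    - The pointwise critical cones are convex cones, each of which contains with
      a number all numbers of the same sign, so a sum of terms that have the sign
      of [z] stays critical ([Kptw_sign], [KptwD]).
    - Where [z > 0] the point is not in [A] or in [B_+], so [y < r]; on the compact
      support of a positive term the continuous [y] therefore stays away from
      [r], which makes this term a radial direction ([radial_nonneg_bump]), and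
      symmetrically for negative terms.  Radial directions form a convex cone
      ([radialD]), hence the finite sum is radial.

    The remaining work is classical: the smooth partition of unity is built from
    [exp (- 1 / x)], regulated functions are bounded and have one-sided limits,
    and Lipschitz functions are regulated. *)

(** * Smooth functions *)

(** The derivative is given existentially, so that closure under an operation
    follows by induction from the rule for the first derivative alone. *)
Fixpoint times_derivable (R : realType) (n : nat) (f : R -> R) : Prop :=
  if n is m.+1 then
    exists2 g : R -> R, forall x : R, is_derive x 1 f (g x) & times_derivable m g
  else True.

Definition smooth (R : realType) (f : R -> R) : Prop :=
  forall n, times_derivable n f.

Section smooth_functions.
Context {R : realType}.
Implicit Types f g : R -> R.

Lemma times_derivableS n f : times_derivable n.+1 f -> times_derivable n f.
Proof.
elim: n f => [//|n IHn] f [g dfg /IHn Hg].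
by exists g.
Qed.

Lemma smooth_derivable1n f : smooth f ->
  forall n x, derivable (derive1n n f) x 1.
Proof.
move=> sf n; have {sf} := sf n.+1.
elim: n f => [|n IHn] f [g dfg Hg] x; first by have [] := dfg x.
rewrite derive1Sn; suff -> : derive1 f = g by exact: IHn.
by apply/funext => t; rewrite derive1E; have [_ ->] := dfg t.
Qed.

Lemma smooth_cst (c : R) : smooth (cst c).
Proof.
move=> n; elim: n c => [//|n IHn] c.
by exists (cst 0) => // x; exact: is_derive_cst.
Qed.

Lemma times_derivableD n f g : times_derivable n f -> times_derivable n g ->
  times_derivable n (fun x => f x + g x).
Proof.
elim: n f g => [//|n IHn] f g [f' df f'n] [g' dg g'n].
exists (fun x => f' x + g' x); last exact: IHn.
by move=> x; exact: is_deriveD.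
Qed.

Lemma times_derivableM n f g : times_derivable n f -> times_derivable n g ->
  times_derivable n (fun x => f x * g x).
Proof.
elim: n f g => [//|n IHn] f g fn gn.
have [f' df f'n] := fn; have [g' dg g'n] := gn.
exists (fun x => f x * g' x + g x * f' x); last first.
  by apply: times_derivableD; apply: IHn => //; exact: times_derivableS.
by move=> x; exact: is_deriveM.
Qed.

(** The derivative [- f' / f ^ 2] is a product of [f'] and two copies of [1 / f],
    to which the induction hypothesis applies. *)
Lemma times_derivableV n f : (forall x, f x != 0) -> times_derivable n f ->
  times_derivable n (fun x => (f x)^-1).
Proof.
move=> f0; elim: n => [//|n IHn] fn.
have [f' df f'n] := fn; have fVn := IHn (times_derivableS fn).
exists (fun x => (-1 * ((f x)^-1 * (f x)^-1)) * f' x); last first.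
  apply: times_derivableM => //; apply: times_derivableM; first exact: smooth_cst.
  exact: times_derivableM.
move=> x; have [fx <-] := df x.
apply: DeriveDef; first exact: derivableV.
by rewrite deriveV// mulN1r exprSr expr1 invfM.
Qed.

Lemma smoothD f g : smooth f -> smooth g -> smooth (fun x => f x + g x).
Proof. by move=> sf sg n; exact: times_derivableD. Qed.

Lemma smoothM f g : smooth f -> smooth g -> smooth (fun x => f x * g x).
Proof. by move=> sf sg n; exact: times_derivableM. Qed.

Lemma smoothV f : (forall x, f x != 0) -> smooth f -> smooth (fun x => (f x)^-1).
Proof. by move=> f0 sf n; exact: times_derivableV. Qed.

Lemma smooth_affine f (a b : R) : smooth f -> smooth (fun x => f (a * x + b)).
Proof.
move=> sf n; have {sf} := sf n.
elim: n f => [//|n IHn] f [f' df f'n].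
exists (fun x => a * f' (a * x + b)); last first.
  by apply: times_derivableM; [exact: smooth_cst|exact: IHn].
move=> x; have dax : is_derive x 1 (fun x : R => a * x + b) a.
  by apply: is_derive_eq; rewrite ?addr0 ?scaler0 ?add0r /GRing.scale /= ?mulr1.
have := @is_derive1_comp R f (fun x => a * x + b) x _ _ (df (a * x + b)) dax.
by rewrite mulrC.
Qed.
End smooth_functions.

(** * A smooth partition of unity *)

Section flat_functions.
Context {R : realType}.
Implicit Types x : R.

(** [exp (- 1 / x)], extended by [0], is the case [m = 0]; the factors [x ^- m]
    make the family closed under differentiation up to linear combinations. *)
Definition flat (m : nat) x : R :=
  if 0 < x then x ^- m * expR (- x^-1) else 0.

Lemma flat_gt0 m x : 0 < x -> 0 < flat m x.
Proof. by move=> x0; rewrite /flat x0 mulr_gt0 ?expR_gt0 ?invr_gt0 ?exprn_gt0. Qed.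

Lemma flat_eq0 m x : x <= 0 -> flat m x = 0.
Proof. by move=> x0; rewrite /flat ltNge x0. Qed.

Lemma flat_ge0 m x : 0 <= flat m x.
Proof. by have [/flat_eq0 ->|/flat_gt0/ltW] := leP x 0. Qed.

(** The exponential series gives [exp (1 / x) >= x ^- (m + 2) / (m + 2)!]; the
    two spare powers of [x] force a zero derivative at the origin. *)
Lemma flat_le_sqr m x : flat m x <= (m.+2)`!%:R * x ^+ 2.
Proof.
have [x0|x0] := leP x 0; first by rewrite flat_eq0// mulr_ge0 ?sqr_ge0.
rewrite /flat x0 expRN.
have f0 : (0 : R) < (m.+2)`!%:R by rewrite ltr0n fact_gt0.
have xV0 : 0 <= x^-1 by rewrite invr_ge0 ltW.
have le_exp : x^-1 ^+ m.+2 / (m.+2)`!%:R <= expR x^-1.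
  by apply: le_trans (expR_ge1Dxn m.+1 xV0); rewrite lerDr.
rewrite ler_pdivrMr ?expR_gt0//.
apply: le_trans (ler_wpM2l _ le_exp); last by rewrite mulr_ge0 ?sqr_ge0 ?ltW.
rewrite le_eqVlt; apply/orP; left; apply/eqP.
rewrite exprVn -addn2 exprD; field.
by rewrite !gt_eqF ?exprn_gt0//= andbT addn2.
Qed.

Lemma is_derive0_sqr (f : R -> R) (C : R) :
  (forall x, `|f x| <= C * x ^+ 2) -> is_derive (0 : R) 1 f 0.
Proof.
move=> fC.
have f00 : f 0 = 0.
  by apply/normr0_eq0/le_anti; rewrite normr_ge0 andbT (le_trans (fC 0))// expr0n mulr0.
suff : h^-1 *: (f (h *: 1 + 0) - f 0) @[h --> 0^'] --> (0 : R).
  move=> cf0; apply: DeriveDef; first by apply/cvg_ex; exists 0.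
  exact: cvg_lim.
have cvgC c : c * `|h| @[h --> (0 : R)^'] --> (0 : R).
  have norm0 : `|h| @[h --> (0 : R)^'] --> `|0 : R| by apply: cvg_norm; exact: nbhs_dnbhs.
  have := cvgM (cvg_cst c) norm0; rewrite normr0 mulr0; exact.
apply: (@squeeze_cvgr _ _ _ _ (fun h => - C * `|h|) (fun h => C * `|h|)); [|exact: cvgC..].
near=> h; rewrite mulNr -ler_norml f00 subr0 addr0 normrM /= [h *: 1]mulr1.
have h0 : h != 0 by near: h; exact: nbhs_dnbhs_neq.
by rewrite normfV ler_pdivrMl ?normr_gt0// mulrCA -normrM -expr2 ger0_norm ?sqr_ge0.
Unshelve. all: by end_near. Qed.

Lemma is_derive_flat m x :
  is_derive x 1 (flat m) (flat m.+2 x + (- m%:R) * flat m.+1 x).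
Proof.
have [x0|x0|->] := ltgtP x 0.
- rewrite !flat_eq0 ?(ltW x0)// mulr0 addr0.
  apply: (@near_eq_is_derive _ _ _ (cst (0 : R))).
  by near=> t; rewrite flat_eq0// ltW//; near: t; exact: lt_nbhsl.
- have xn0 : x != 0 by rewrite gt_eqF.
  have flatE : \near x, x^-1 ^+ m * expR (- x^-1) = flat m x.
    by near=> t; rewrite /flat ifT ?exprVn//; near: t; exact: lt_nbhsr.
  have dV : is_derive x 1 (fun t : R => t^-1) (- x ^- 2).
    by apply: DeriveDef; [exact: derivableV|rewrite deriveV// derive_id /GRing.scale/= mulr1].
  have dX : is_derive x 1 (fun t : R => t^-1 ^+ m) (m%:R * x^-1 ^+ m.-1 * (- x ^- 2)).
    have := @is_deriveX _ _ (fun t : R => t^-1) m x 1 _ dV.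
    by rewrite exprfctE; exact.
  have dE : is_derive x 1 (fun t : R => expR (- t^-1)) (expR (- x^-1) * x ^- 2).
    have dN := is_deriveN dV; rewrite opprK in dN.
    exact: (@is_derive1_comp R expR (fun t => - t^-1) x _ _ (is_derive_expR _) dN).
  refine (near_eq_is_derive flatE (is_derive_eq (is_deriveM dX dE) _)).
  rewrite /flat x0 /GRing.scale/= !exprVn.
  case: m {dX flatE} => [|m]; rewrite ?mul0r ?mulr0 ?oppr0 ?addr0 ?mul0r ?addr0 /=.
    by rewrite expr0 invr1 !mul1r; ring.
  by rewrite !exprS; field; rewrite expf_neq0.
- rewrite !flat_eq0// mulr0 addr0.
  apply: (@is_derive0_sqr _ (m.+2)`!%:R) => t.
  by rewrite ger0_norm ?flat_ge0// flat_le_sqr.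
Unshelve. all: by end_near. Qed.

Lemma smooth_flat m : smooth (flat m).
Proof.
move=> n; elim: n m => [//|n IHn] m.
exists (fun x => flat m.+2 x + (- m%:R) * flat m.+1 x); first exact: is_derive_flat.
by apply: times_derivableD => //; apply: times_derivableM => //; exact: smooth_cst.
Qed.

(** The two summands of the denominator never vanish together, because [x] and
    [1 - x] are not both nonpositive. *)
Definition smooth_step x : R := flat 0 x / (flat 0 x + flat 0 (1 - x)).

Let denom_gt0 x : 0 < flat 0 x + flat 0 (1 - x).
Proof.
have [x0|x0] := leP x 0.
  by rewrite ltr_wpDl ?flat_ge0 ?flat_gt0//; lra.
by rewrite ltr_pwDl ?flat_ge0 ?flat_gt0.
Qed.

Lemma smooth_smooth_step : smooth smooth_step.
Proof.
apply: smoothM; first exact: smooth_flat.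
apply: smoothV; first by move=> x; rewrite gt_eqF.
apply: smoothD; first exact: smooth_flat.
have -> : (fun x => flat 0 (1 - x)) = (fun x => flat 0 (-1 * x + 1)).
  by apply/funext => x; rewrite mulN1r addrC.
by apply: smooth_affine; exact: smooth_flat.
Qed.

Lemma smooth_step_le0 x : x <= 0 -> smooth_step x = 0.
Proof. by move=> x0; rewrite /smooth_step flat_eq0// mul0r. Qed.

Lemma smooth_step_ge1 x : 1 <= x -> smooth_step x = 1.
Proof.
move=> x1; rewrite /smooth_step (@flat_eq0 _ (1 - x)) ?addr0 ?subr_le0//.
by rewrite divff// gt_eqF// flat_gt0// (lt_le_trans ltr01).
Qed.

Lemma smooth_step_ge0 x : 0 <= smooth_step x.
Proof. by rewrite divr_ge0 ?flat_ge0 ?ltW. Qed.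

Lemma smooth_step_le1 x : smooth_step x <= 1.
Proof. by rewrite ler_pdivrMr// mul1r lerDl flat_ge0. Qed.

(** A difference of two steps, so that the sum of its integer translates
    telescopes ([sum_hat]). *)
Definition hat x : R := smooth_step (x + 1) - smooth_step x.

Lemma hat_ge0 x : 0 <= hat x.
Proof.
rewrite /hat subr_ge0; have [x0|x0] := leP x 0.
  by rewrite (smooth_step_le0 x0) smooth_step_ge0.
by rewrite (@smooth_step_ge1 (x + 1)) ?smooth_step_le1//; lra.
Qed.

Lemma hat_le1 x : hat x <= 1.
Proof.
rewrite /hat; have := smooth_step_le1 (x + 1); have := smooth_step_ge0 x; lra.
Qed.

Lemma hat_eq0 x : 1 < `|x| -> hat x = 0.
Proof.
rewrite /hat ltr_normr => /orP[x1|x1].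
  by rewrite !smooth_step_ge1 ?subrr//; lra.
by rewrite !smooth_step_le0 ?subrr//; lra.
Qed.

Lemma smooth_hat_affine (a b : R) : smooth (fun x => hat (a * x + b)).
Proof.
have -> : (fun x => hat (a * x + b)) =
    (fun x => smooth_step (a * x + (b + 1)) + (-1) * smooth_step (a * x + b)).
  by apply/funext => x; rewrite /hat mulN1r addrA.
by apply: smoothD; [|apply: smoothM; first exact: smooth_cst];
  apply: smooth_affine; exact: smooth_smooth_step.
Qed.

Lemma sum_hat (n : nat) x : 0 <= x <= n%:R -> \sum_(k < n.+1) hat (x - k%:R) = 1.
Proof.
move=> /andP[x0 xn].
have -> : \sum_(k < n.+1) hat (x - k%:R) =
    smooth_step (x + 1) - smooth_step (x - n%:R).
  elim: n {xn} => [|n IHn]; first by rewrite big_ord1 subr0.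
  have succ : x - n.+1%:R + 1 = x - n%:R by rewrite -natr1; ring.
  by rewrite big_ord_recr/= IHn /hat succ; ring.
by rewrite smooth_step_ge1 ?smooth_step_le0 ?subr0//; lra.
Qed.

End flat_functions.

(** * Regulated functions *)

Section regulated_functions.
Context {R : realType}.
Implicit Types (f g v : R -> R) (T : R).

Lemma uniform_segmentP T (f : nat -> R -> R) v :
  {uniform `[0, T], f @ \oo --> v} <->
  forall e, 0 < e -> \forall n \near \oo,
    forall t, 0 <= t <= T -> `|v t - f n t| < e.
Proof.
split=> [fv e e0|fv P /uniform_nbhs[E [entE EP]]].
  apply: (fv [set h | forall t, 0 <= t <= T -> `|v t - h t| < e]).
  apply/uniform_nbhs; exists [set xy | `|xy.1 - xy.2| < e]; split.
    exact: (entourage_ball R (PosNum e0)).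
  by move=> h hE t t0T; apply: hE; rewrite /= in_itv.
apply: filterS EP _.
move: entE; rewrite -entourage_ballE => -[e /= e0 eE].
apply: filterS (fv e e0) => n fn t; rewrite /= in_itv/= => t0T.
by apply: eE; exact: fn.
Qed.

Lemma itv_partition_left (a b t : R) s : itv_partition a b s -> a < t <= b ->
  exists2 i, (i < size s)%N & nth b (a :: s) i < t <= nth b s i.
Proof.
elim: s a => [|x s IHs] a; first by move=> /itv_partition_nil ->; lra.
move=> /[dup] /itv_partition_cons /IHs {}IHs _ /andP[at_ tb].
have [tx|xt] := leP t x; first by exists 0%N; rewrite //= at_.
by have [|i si ti] := IHs; [rewrite xt|exists i.+1].
Qed.

Lemma itv_partition_right (a b t : R) s : itv_partition a b s -> a <= t < b ->
  exists2 i, (i < size s)%N & nth b (a :: s) i <= t < nth b s i.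
Proof.
elim: s a => [|x s IHs] a; first by move=> /itv_partition_nil ->; lra.
move=> /[dup] /itv_partition_cons /IHs {}IHs _ /andP[at_ tb].
have [xt|tx] := leP x t; last by exists 0%N; rewrite //= at_.
by have [|i si ti] := IHs; [rewrite xt|exists i.+1].
Qed.

Lemma step_function_bounded T f : step_function T f ->
  exists M, forall t, 0 <= t <= T -> `|f t| <= M.
Proof.
case=> s; elim: s 0 => [|x s IHs] a.
  by move=> /itv_partition_nil <- _; exists `|f a| => t /le_anti ->.
move=> /itv_partition_cons /IHs {}IHs fs.
have [c fc] := fs 0%N isT.
have [|M fM] := IHs; first by move=> i si; exact: (fs i.+1 si).
exists (`|f a| + `|c| + `|M|) => t /andP[].
rewrite le_eqVlt => /predU1P[<- _|at_ tT].
  by rewrite -addrA lerDl addr_ge0.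
have [tx|xt] := ltP t x.
  by rewrite (fc t) ?at_//= addrAC lerDr addr_ge0.
by rewrite (le_trans (fM t _)) ?xt// (le_trans (ler_norm M))// lerDr addr_ge0.
Qed.

Lemma regulated_approx T v e : regulated T v -> 0 < e ->
  exists2 f, step_function T f & forall t, 0 <= t <= T -> `|v t - f t| < e.
Proof.
move=> [f fstep /uniform_segmentP fv] /fv[N _ fN].
by exists (f N) => //; exact: fN (leqnn N).
Qed.

Lemma regulated_bounded T v : regulated T v ->
  exists M, forall t, 0 <= t <= T -> `|v t| <= M.
Proof.
move=> /regulated_approx/(_ ltr01)[f /step_function_bounded[M fM] vf].
exists (M + 1) => t t0T; have := fM t t0T; have := vf t t0T.
have := ler_normD (v t - f t) (f t); rewrite subrK; lra.
Qed.

(** Immediately to the left of [t], an approximating step function is constant,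
    so [v] stays within [e] of one number: the Cauchy criterion holds. *)
Lemma regulated_cvg_left T v t : regulated T v -> 0 < t <= T ->
  v x @[x --> t^'-] --> left_limit v t.
Proof.
move=> reg_v /andP[t0 tT]; rewrite /left_limit t0.
apply/cauchy_cvgP/cauchy_exP => e e0 /=.
have [f [s sT fs] vf] := regulated_approx reg_v e0.
have [|i si /andP[xt ty]] := itv_partition_left sT (t := t); first by rewrite t0.
have [c fc] := fs i si.
exists c; rewrite /fmap /=; near=> x.
have xi : nth T (0 :: s) i < x by near: x; exact: nbhs_left_gt.
have xt' : x < t by near: x; exact: nbhs_left_lt.
rewrite /ball/= distrC -(fc x) ?xi ?(lt_le_trans xt' ty)//.
apply: vf; apply/andP; split; last by rewrite (le_trans (ltW xt')).
by near: x; exact: nbhs_left_ge.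
Unshelve. all: by end_near. Qed.

Lemma regulated_cvg_right T v t : regulated T v -> 0 <= t < T ->
  v x @[x --> t^'+] --> right_limit T v t.
Proof.
move=> reg_v /andP[t0 tT]; rewrite /right_limit tT.
apply/cauchy_cvgP/cauchy_exP => e e0 /=.
have [f [s sT fs] vf] := regulated_approx reg_v e0.
have [|i si /andP[xt ty]] := itv_partition_right sT (t := t); first by rewrite t0.
have [c fc] := fs i si.
exists c; rewrite /fmap /=; near=> x.
have xi : x < nth T s i by near: x; exact: nbhs_right_lt.
have tx : t < x by near: x; exact: nbhs_right_gt.
rewrite /ball/= distrC -(fc x) ?xi ?(le_lt_trans xt tx)//.
apply: vf; apply/andP; split; first by rewrite (le_trans _ (ltW tx)).
by near: x; exact: nbhs_right_le.
Unshelve. all: by end_near. Qed.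

(** The step functions freeze [g] at the left end of each cell of the uniform
    partition into [n + 1] cells, with an error of at most [L * T / (n + 1)]. *)
Lemma lipschitz_regulated T (L : R) g : 0 < T ->
  (forall s t, 0 <= s <= T -> 0 <= t <= T -> `|g s - g t| <= L * `|s - t|) ->
  regulated T g.
Proof.
move=> T0 gL.
pose node n k : R := T / n.+1%:R * k%:R.
pose cell n x := Num.truncn (x / (T / n.+1%:R)).
have h0 n : 0 < T / n.+1%:R by rewrite divr_gt0.
have nodeT n : node n n.+1 = T by rewrite /node divfK.
have nodeS n k : node n k.+1 = node n k + T / n.+1%:R.
  by rewrite /node -[k.+1%:R]natr1 mulrDr mulr1.
have cell_itv n x : 0 <= x <= T -> node n (cell n x) <= x < node n (cell n x).+1.
  move=> /andP[x0 _]; rewrite /node ![T / _ * _]mulrC -ler_pdivlMr// -ltr_pdivrMr//.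
  by apply: truncn_itv; rewrite divr_ge0// ltW.
exists (fun n x => g (node n (cell n x))) => [n|].
  pose s := mkseq (fun k => node n k.+1) n.+1.
  have nthE x0 i : (i <= n.+1)%N -> nth x0 (0 :: s) i = node n i.
    case: i => [|i] ni /=; first by rewrite /node mulr0.
    by rewrite nth_mkseq.
  have sizeE : size s = n.+1 by rewrite size_mkseq.
  exists s.
    split.
      apply/(pathP 0) => i ni; have {}ni : (i < n.+1)%N := leq_trans ni (eq_leq sizeE).
      change (nth (0 : R) (0 :: s) i < nth 0 (0 :: s) i.+1).
      by rewrite !nthE ?(ltnW ni)// /node ltr_pM2l// ltr_nat.
    have lastE : nth 0 (0 :: s) n.+1 = last 0 s.
      by rewrite -{1}sizeE; exact: (nth_last (0 : R) (0 :: s)).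
    by rewrite -lastE nthE// nodeT.
  move=> i; rewrite sizeE => ni; exists (g (node n i)) => x.
  rewrite (nthE _ _ (ltnW ni)) -[nth T s i]/(nth T (0 :: s) i.+1) nthE//.
  rewrite /node ![T / _ * _]mulrC -(ltr_pdivrMr _ _ (h0 n)) -(ltr_pdivlMr _ _ (h0 n)) => /andP[ix xi].
  by rewrite /cell (@truncn_def _ _ i) ?(ltW ix)//.
apply/uniform_segmentP => e e0.
have L0 : 0 < `|L| + 1 by rewrite ltr_wpDl.
have eLT0 : 0 < e / ((`|L| + 1) * T) by rewrite divr_gt0// mulr_gt0.
near=> n => t t0T; have /andP[lt_ tl] := cell_itv n _ t0T.
have node0 : 0 <= node n (cell n t) <= T.
  case/andP: t0T => _ /(le_trans lt_) ->; rewrite andbT mulr_ge0// ltW//.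
apply: le_lt_trans (gL _ _ t0T node0) _.
have d_le : `|t - node n (cell n t)| <= T / n.+1%:R.
  rewrite ger0_norm ?subr_ge0// lerBlDl.
  by rewrite -nodeS ltW.
have L_le : L <= `|L| + 1 by rewrite (le_trans (ler_norm L))// lerDl.
apply: le_lt_trans (ler_wpM2r _ L_le) _ => //.
apply: le_lt_trans (ler_wpM2l (ltW L0) d_le) _.
rewrite mulrA mulrC -ltr_pdivlMr ?mulr_gt0//.
by near: n; exact: (near_infty_natSinv_lt (PosNum eLT0)).
Unshelve. all: by end_near. Qed.
End regulated_functions.

Section smooth_regulated.
Context {R : realType}.
Implicit Types (f : R -> R) (a b T : R).

Lemma smooth_is_derive f : smooth f ->
  exists2 g, forall x : R, is_derive x 1 f (g x) & smooth g.
Proof.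
move=> sf; have [g dfg _] := sf 1%N; exists g => // n.
have [g' dfg' g'n] := sf n.+1.
suff -> : g = g' by [].
by apply/funext => x; have [_ <-] := dfg x; have [_ ->] := dfg' x.
Qed.

Lemma smooth_continuous f : smooth f -> continuous f.
Proof.
move=> /smooth_is_derive[g dfg _] x; have [fx _] := dfg x.
exact/differentiable_continuous/derivable1_diffP.
Qed.

(** The mean value theorem, with the maximum of the absolute value of the
    derivative as Lipschitz constant. *)
Lemma smooth_lipschitz f a b : a <= b -> smooth f ->
  exists L, forall s t, a <= s <= b -> a <= t <= b ->
    `|f s - f t| <= L * `|s - t|.
Proof.
move=> ab sf; have [g dfg /smooth_continuous cg] := smooth_is_derive sf.
have cng : {within `[a, b], continuous (fun x => `|g x|)}.
  by apply: continuous_subspaceT => x; apply: continuous_comp; [exact: cg|exact: norm_continuous].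
have [c _ gc] := EVT_max ab cng.
have cf : continuous f := smooth_continuous sf.
exists `|g c| => s t.
wlog st : s t / s <= t.
  move=> W sab tab; have [st|/ltW ts] := leP s t; first exact: W.
  by have := W t s ts tab sab; rewrite distrC [`|t - s|]distrC.
move=> /andP[as_ sb] /andP[at_ tb].
have [//|x /=] := @MVT_segment R f g s t st (fun x _ => dfg x).
  by apply: continuous_subspaceT => x; exact: cf.
rewrite in_itv/= => /andP[sx xt] dst.
rewrite distrC dst normrM [`|s - t|]distrC ler_wpM2r//.
by apply: gc; rewrite in_itv/= (le_trans as_ sx) (le_trans xt tb).
Qed.

Lemma smooth_Gr f T : 0 < T -> smooth f -> Gr T f.
Proof.
move=> T0 sf; split.
  by have [L /(lipschitz_regulated T0)] := smooth_lipschitz (ltW T0) sf.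
move=> t _; rewrite /right_limit; case: ifPn => // _; apply/esym/cvg_lim => //.
exact/cvg_at_right_filter/(smooth_continuous sf).
Qed.

End smooth_regulated.

(** * Critical and radial directions *)

Section critical_cones.
Context {R : realType} (T r : R) (y u : R -> R).
Context (r_gt0 : 0 < r).
Implicit Types (t a b : R) (z : R -> R).

(** The content is that the four cases exhaust [[0, T]]: outside of them the cone
    would be empty. *)
Lemma Kptw0 t : 0 <= t <= T -> Zset r (y t) -> Kptw T r y u t 0.
Proof.
rewrite /Kptw /Zset /= in_itv/= => t0T /andP[ry yr].
case: ifPn => // /negP nI; case: ifPn => [_ /=|/negP nB]; first exact: lexx.
case: ifPn => [_ /=|/negP nB']; first exact: lexx.
case: ifPn => // /negP; apply; rewrite inE.
have yE : `|y t| = r.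
  apply/eqP; apply: contra_notT nI => yr'; rewrite inE; split=> //.
  by rewrite lt_neqAle yr' ler_norml ry yr.
have y_r : y t = r \/ y t = - r.
  by move: yE; case: (ger0P (y t)) => _ <-; [left|right; rewrite opprK].
split=> //.
  case/andP: (t0T) => t0; rewrite t0 le_eqVlt => /predU1P[tT|//]; exfalso.
  by case: y_r => yr'; [apply: nB|apply: nB']; rewrite inE; split=> //; left.
by move=> lc; case: y_r => yr'; [apply: nB|apply: nB']; rewrite inE; split=> //; right.
Qed.

Lemma KptwD t a b : Kptw T r y u t a -> Kptw T r y u t b ->
  Kptw T r y u t (a + b).
Proof.
rewrite /Kptw; case: ifP => _ //; case: ifP => _ /=; first by lra.
case: ifP => _ /=; first by lra.
by case: ifP => _ //= -> ->; rewrite addr0.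
Qed.

(** A nonempty cone here is the line, a half-line or the origin. *)
Lemma Kptw_sign t a b : 0 < a * b -> Kptw T r y u t a -> Kptw T r y u t b.
Proof.
rewrite /Kptw => ab0; case: ifP => _ //; case: ifP => _ /=; first by nra.
case: ifP => _ /=; first by nra.
by case: ifP => _ //= a0; rewrite a0 mul0r ltxx in ab0.
Qed.

(** A nonzero critical value has a sign that points away from the active
    constraint, so the constraint on the side it points to is inactive. *)
Lemma Kptw_gt0 t a : 0 < a -> Kptw T r y u t a -> y t < r.
Proof.
rewrite /Kptw; case: ifPn => [|_].
  by rewrite inE => -[_ /ltr_normlP[_ ?]].
case: ifPn => [_ /= a0 /(lt_le_trans a0)|_]; first by rewrite ltxx.
case: ifPn => [|_]; first by rewrite inE => -[_ -> _] _ _; rewrite gtrN.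
by case: ifPn => [_ + /= a0|_ _ []//]; rewrite a0 ltxx.
Qed.

Lemma Kptw_lt0 t a : a < 0 -> Kptw T r y u t a -> - r < y t.
Proof.
rewrite /Kptw; case: ifPn => [|_].
  by rewrite inE => -[_ /ltr_normlP[? _]] _ _; rewrite ltrNl.
case: ifPn => [|_]; first by rewrite inE => -[_ -> _] _ _; rewrite gtrN.
case: ifPn => [_ /= a0 /le_lt_trans/(_ a0)|_]; first by rewrite ltxx.
by case: ifPn => [_ + /= a0|_ _ []//]; rewrite a0 ltxx.
Qed.

End critical_cones.

Section radial_directions.
Context {R : realType} (T r : R) (y : R -> R).

Definition radial (z : R -> R) : Prop :=
  exists2 a : R, 0 < a & forall t, 0 <= t <= T -> Zset r (y t + a * z t).

(** If the steps [a] and [b] are admissible for [z1] and [z2], then the step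
    [a * b / (a + b)] along [z1 + z2] leads to a convex combination of the points
    reached separately, and [Z] is convex. *)
Lemma radialD z1 z2 : radial z1 -> radial z2 -> radial (fun t => z1 t + z2 t).
Proof.
move=> [a a0 az1] [b b0 bz2]; have ab0 : 0 < a + b by rewrite addr_gt0.
exists (a * b / (a + b)) => [|t t0T]; first by rewrite divr_gt0// mulr_gt0.
have := az1 t t0T; have := bz2 t t0T; rewrite /Zset/= !in_itv/=.
move=> /andP[l2 u2] /andP[l1 u1].
have -> : y t + a * b / (a + b) * (z1 t + z2 t) =
    (b * (y t + a * z1 t) + a * (y t + b * z2 t)) / (a + b).
  by field; rewrite gt_eqF.
rewrite ler_pdivlMr// ler_pdivrMr//; apply/andP; split; nra.
Qed.

Lemma radial0 : (forall t, 0 <= t <= T -> Zset r (y t)) -> radial (fun=> 0).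
Proof. by move=> yZ; exists 1 => // t; rewrite mulr0 addr0; exact: yZ. Qed.

End radial_directions.

Section radial_bumps.
Context {R : realType} (T r : R).

Lemma radialN (y z : R -> R) :
  radial T r (fun t => - y t) (fun t => - z t) -> radial T r y z.
Proof.
move=> [a a0 az]; exists a => // t /az; rewrite /Zset/= !in_itv/= => ?; lra.
Qed.

(** By compactness [y] has a maximum [y c < r] on the interval around [p] that
    carries [b], which leaves room for a step of length [r - y c]; the lower
    constraint is not at risk since [b] is nonnegative. *)
Lemma radial_nonneg_bump (y b : R -> R) (p h M : R) :
  0 <= p <= T -> 0 <= h -> {within `[0, T], continuous y} ->
  (forall t, 0 <= t <= T -> Zset r (y t)) ->
  (forall t, 0 <= t <= T -> `|t - p| <= h -> y t < r) ->
  (forall t, 0 <= b t <= M) -> (forall t, h < `|t - p| -> b t = 0) ->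
  radial T r y b.
Proof.
move=> /andP[p0 pT] h0 cy yZ y_lt bM b0.
have M0 : 0 <= M by have /andP[] := bM 0; exact: le_trans.
pose lo := Num.max 0 (p - h); pose hi := Num.min T (p + h).
have memE t : (lo <= t <= hi) = (0 <= t <= T) && (`|t - p| <= h).
  rewrite ge_max le_min ler_norml; apply/idP/idP; lra.
have lohi : lo <= hi.
  by rewrite (@le_trans _ _ p)// ?ge_max ?le_min ?p0 ?pT/=; lra.
have cy' : {within `[lo, hi], continuous y}.
  by apply: continuous_subspaceW cy => t /=; rewrite !in_itv/= memE => /andP[].
have [c + yc] := EVT_max lohi cy'.
rewrite in_itv/= memE => /andP[c0T /(y_lt c c0T) ycr].
have M1 : 0 < M + 1 by rewrite ltr_wpDl.
(* [M + 1] instead of [M] avoids a division by zero. *)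
exists ((r - y c) / (M + 1)) => [|t t0T]; first by rewrite divr_gt0 ?subr_gt0.
have := yZ t t0T; rewrite /Zset/= !in_itv/= => /andP[ry yr].
have [/b0 ->|th] := ltP h `|t - p|; first by rewrite mulr0 addr0 ry.
have ytc : y t <= y c by apply: yc; rewrite in_itv/= memE t0T.
have /andP[bt0 btM] := bM t.
have ab : 0 <= (r - y c) / (M + 1) * b t <= r - y c.
  apply/andP; split; first by rewrite mulr_ge0// divr_ge0 ?subr_ge0 ?ltW.
  rewrite -[leRHS]mulr1 -mulrA ler_wpM2l ?subr_ge0 ?(ltW ycr)//.
  by rewrite mulrC ler_pdivrMr//; lra.
lra.
Qed.

End radial_bumps.

(** * Sampling a function where its sign is stable *)

Section hat_approximation.
Context {R : realType} (T : R).
Context (T_gt0 : 0 < T).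
Implicit Types (z : R -> R) (n k : nat) (t : R).

Definition mesh n : R := T / n.+1%:R.

Definition anchor n k : R := mesh n * k%:R.

Definition anchored_hat n k t : R := hat ((mesh n)^-1 * t + - k%:R).

(** The condition covers the whole support of the bump at the anchor. *)
Definition sign_stable z n k : Prop :=
  forall s, 0 <= s <= T -> `|s - anchor n k| <= mesh n ->
    0 < z s * z (anchor n k).

Definition anchor_coef z n k : R :=
  if `[< sign_stable z n k >] then z (anchor n k) else 0.

Definition hat_approx z n t : R :=
  \sum_(k < n.+2) anchor_coef z n k * anchored_hat n k t.

Lemma mesh_gt0 n : 0 < mesh n.
Proof. by rewrite divr_gt0. Qed.

Lemma anchor_in n k : (k <= n.+1)%N -> 0 <= anchor n k <= T.
Proof.
move=> kn; rewrite mulr_ge0 ?(ltW (mesh_gt0 n))//=.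
by rewrite /anchor /mesh mulrAC ler_pdivrMr// ler_pM2l// ler_nat.
Qed.

Lemma anchored_hat_eq0 n k t : mesh n < `|t - anchor n k| -> anchored_hat n k t = 0.
Proof.
move=> far; apply: hat_eq0; have h0 := mesh_gt0 n.
have -> : (mesh n)^-1 * t + - k%:R = (mesh n)^-1 * (t - anchor n k).
  by rewrite mulrBr mulKf// gt_eqF.
by rewrite normrM gtr0_norm ?invr_gt0// mulrC ltr_pdivlMr// mul1r.
Qed.

Lemma anchored_hat_near n k t : anchored_hat n k t != 0 -> `|t - anchor n k| <= mesh n.
Proof. by apply: contra_neqT; rewrite -ltNge; exact: anchored_hat_eq0. Qed.

Lemma sum_anchored_hat n t : 0 <= t <= T -> \sum_(k < n.+2) anchored_hat n k t = 1.
Proof.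
move=> /andP[t0 tT]; apply: sum_hat.
rewrite mulr_ge0 ?invr_ge0 ?(ltW (mesh_gt0 n))//=.
by rewrite mulrC ler_pdivrMr ?mesh_gt0// mulrC /mesh divfK.
Qed.

Lemma anchored_hat_ge0 n k t : 0 <= anchored_hat n k t.
Proof. exact: hat_ge0. Qed.

Lemma anchor_coef_stable z n k : anchor_coef z n k != 0 ->
  sign_stable z n k /\ anchor_coef z n k = z (anchor n k).
Proof. by rewrite /anchor_coef; case: asboolP => //; rewrite eqxx. Qed.

(** In particular, at a zero of [z] every term of the approximation vanishes. *)
Lemma hat_term_sign z n k t : 0 <= t <= T ->
  anchor_coef z n k * anchored_hat n k t != 0 -> 0 < z t * anchor_coef z n k.
Proof.
move=> t0T; rewrite mulf_eq0 negb_or => /andP[/anchor_coef_stable[stable ->]].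
by move=> /anchored_hat_near; exact: stable.
Qed.

Lemma hat_approx_le z n t (M : R) : (forall s, 0 <= s <= T -> `|z s| <= M) ->
  0 <= t <= T -> `|hat_approx z n t| <= M.
Proof.
move=> zM t0T; apply: le_trans (ler_norm_sum _ _ _) _.
rewrite -[M]mulr1 -(sum_anchored_hat n t0T) mulr_sumr; apply: ler_sum => k _.
rewrite normrM (ger0_norm (anchored_hat_ge0 _ _ _)) ler_wpM2r ?anchored_hat_ge0//.
rewrite /anchor_coef; case: asboolP => _; last first.
  by rewrite normr0 (le_trans _ (zM t t0T)).
by apply: zM; apply: anchor_in; rewrite -ltnS.
Qed.

(** Both [z t] and the approximation are averages with the same weights, so it
    suffices to compare the coefficients of the bumps that reach [t].  Their
    anchors lie within one mesh of [t]. *)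
Lemma hat_approx_cvg z t : 0 <= t <= T ->
  (z t != 0 -> forall e, 0 < e -> exists2 d, 0 < d &
     forall s, 0 <= s <= T -> `|s - t| < d -> `|z s - z t| < e) ->
  hat_approx z n t @[n --> \oo] --> z t.
Proof.
move=> t0T cz; have [zt0|zt0] := eqVneq (z t) 0.
  suff -> : (fun n => hat_approx z n t) = cst (z t) by exact: cvg_cst.
  apply/funext => n; rewrite /cst zt0; apply: big1 => k _.
  by apply/eqP; apply: contraT => /(hat_term_sign t0T); rewrite zt0 mul0r ltxx.
apply/cvgrPdist_le => e e0.
(* A value of [z] at distance less than [`|z t|] from [z t] has its sign. *)
have [|d d0 zd] := cz zt0 (Num.min e `|z t|); first by rewrite lt_min e0 normr_gt0.
have dT0 : 0 < d / 2 / T by rewrite !divr_gt0.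
near=> n.
(* The points tested for sign stability lie within two meshes of [t]. *)
have h_d : mesh n < d / 2.
  rewrite /mesh mulrC -ltr_pdivlMr//.
  by near: n; exact: (near_infty_natSinv_lt (PosNum dT0)).
rewrite -[z t]mulr1 -(sum_anchored_hat n t0T) mulr_sumr -sumrB.
apply: le_trans (ler_norm_sum _ _ _) _.
rewrite -[e]mulr1 -(sum_anchored_hat n t0T) mulr_sumr; apply: ler_sum => k _.
have p_in : 0 <= anchor n k <= T by apply: anchor_in; rewrite -ltnS.
rewrite -mulrBl normrM (ger0_norm (anchored_hat_ge0 _ _ _)).
have [->|/anchored_hat_near tp] := eqVneq (anchored_hat n k t) 0; first by rewrite !mulr0.
rewrite ler_wpM2r ?anchored_hat_ge0//.
have zp : `|z (anchor n k) - z t| < Num.min e `|z t|.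
  by apply: zd; rewrite // distrC; lra.
have stable : sign_stable z n k.
  move=> s s0T sp.
  have zs : `|z s - z t| < Num.min e `|z t|.
    by apply: zd => //; have := ler_distD (anchor n k) s t; rewrite (distrC (anchor n k)); lra.
  move: zs zp; rewrite !lt_min !ltr_distl => /andP[_ /andP[zs1 zs2]] /andP[_ /andP[zp1 zp2]].
  have [zt_neg|zt_pos|zt_eq] := ltgtP (z t) 0; last by rewrite zt_eq eqxx in zt0.
    by rewrite nmulr_rgt0; rewrite (ltr0_norm zt_neg) in zs2 zp2; lra.
  by rewrite pmulr_rgt0; rewrite (gtr0_norm zt_pos) in zs1 zp1; lra.
have -> : anchor_coef z n k = z (anchor n k) by rewrite /anchor_coef asboolT.
by move: zp; rewrite lt_min distrC => /andP[/ltW].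
Unshelve. all: by end_near. Qed.

End hat_approximation.

(** * Approximation of critical directions *)

Section critical_approximation.
Context {R : realType}.

(** A jump at [t] would force [z t = 0]; continuity from the right is part of the
    definition, and [t = 0] is excluded by [z 0 = 0]. *)
Lemma Kred_crit_continuous (T r : R) (y u z : R -> R) t :
  Kred_crit T r y u z -> 0 <= t <= T -> z t != 0 ->
  forall e, 0 < e -> exists2 d, 0 < d &
    forall s, 0 <= s <= T -> `|s - t| < d -> `|z s - z t| < e.
Proof.
move=> [[reg_z zr] _ z0 zl] /andP[t0 tT] zt0 e e0.
have t_gt0 : 0 < t.
  by rewrite lt_neqAle t0 andbT; apply: contra_neq zt0 => <-.
have [dl dl0 ldl] : exists2 d, 0 < d & forall s, s < t -> `|s - t| < d -> `|z s - z t| < e.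
  have zlt : left_limit z t = z t.
    by apply: contrapT => zlt; move/eqP: zt0; apply; apply: zl => //; rewrite t0.
  have := @regulated_cvg_left _ T z t reg_z; rewrite t_gt0 tT => /(_ isT).
  rewrite zlt => /cvgrPdist_lt/(_ e e0) /nbhs_ballP[d /= d0 dP].
  by exists d => // s st sd; rewrite distrC; apply: dP => //; rewrite /ball/= distrC.
have [dr dr0 rdr] : exists2 d, 0 < d &
    forall s, t < s <= T -> `|s - t| < d -> `|z s - z t| < e.
  have [tT'|Tt] := ltP t T; last first.
    by exists 1 => // s /andP[/lt_le_trans/[apply]]; rewrite ltNge Tt.
  have := @regulated_cvg_right _ T z t reg_z; rewrite t0 tT' => /(_ isT).
  rewrite -zr ?t0// => /cvgrPdist_lt/(_ e e0) /nbhs_ballP[d /= d0 dP].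
  exists d => // s /andP[st _] sd; rewrite distrC; apply: dP => //.
  by rewrite /ball/= distrC.
exists (Num.min dl dr); first by rewrite lt_min dl0.
move=> s /andP[s0 sT]; rewrite lt_min => /andP[sl sr].
by have [st|ts|->] := ltgtP s t; [exact: ldl|apply: rdr; rewrite ?ts|rewrite subrr normr0].
Qed.

(** Smoothness and being radial are properties of whole functions, for which the
    induction principle of big operators does not unify with a pointwise sum. *)
Lemma fun_sum_ind (P : (R -> R) -> Prop) n (F : 'I_n -> R -> R) :
  P (fun=> 0) -> (forall f g, P f -> P g -> P (fun t => f t + g t)) ->
  (forall k, P (F k)) -> P (fun t => \sum_(k < n) F k t).
Proof.
move=> P0 PD PF; elim: n F PF => [|n IHn] F PF.
  by under eq_fun do rewrite big_ord0.
under eq_fun do rewrite big_ord_recr.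
by apply: PD => //; exact: IHn.
Qed.

Lemma smooth_hat_approx (T : R) (z : R -> R) n : smooth (hat_approx T z n).
Proof.
apply: (@fun_sum_ind (@smooth R) n.+2
  (fun k t => anchor_coef T z n k * anchored_hat T n k t));
  [exact: smooth_cst|exact: smoothD|move=> k].
by apply: smoothM; [exact: smooth_cst|exact: smooth_hat_affine].
Qed.

Lemma radial_hat_term (T r : R) (y u z : R -> R) n k : 0 < T -> 0 < r ->
  (k <= n.+1)%N -> {within `[0, T], continuous y} ->
  (forall t, 0 <= t <= T -> Zset r (y t)) ->
  (forall t, 0 <= t <= T -> Kptw T r y u t (z t)) ->
  radial T r y (fun t => anchor_coef T z n k * anchored_hat T n k t).
Proof.
move=> T0 r0 kn cy yZ zK.
have [->|] := eqVneq (anchor_coef T z n k) 0.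
  by under eq_fun do rewrite mul0r; exact: radial0.
move=> /anchor_coef_stable[stable ->].
have h0 : 0 <= mesh T n := ltW (mesh_gt0 T0 n).
have pT := anchor_in T0 kn.
have hat0 t : mesh T n < `|t - anchor T n k| ->
    z (anchor T n k) * anchored_hat T n k t = 0.
  by move=> /(anchored_hat_eq0 T0) ->; rewrite mulr0.
have := stable _ pT; rewrite subrr normr0 => /(_ h0).
have [zp0 _|zp0 _|->] := ltgtP (z (anchor T n k)) 0; last by rewrite mul0r ltxx.
- apply: radialN.
  apply: (@radial_nonneg_bump _ _ _ _ _ (anchor T n k) (mesh T n) (- z (anchor T n k))) => //.
  + by move=> t; apply: continuousN; exact: cy.
  + by move=> t /yZ; rewrite /Zset/= !in_itv/= => ?; lra.
  + move=> t t0T /(stable t t0T) zt.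
    rewrite ltrNl; apply: Kptw_lt0 (zK t t0T) => //; by rewrite -(nmulr_lgt0 _ zp0).
  + move=> t; rewrite -mulNr mulr_ge0 ?anchored_hat_ge0 ?oppr_ge0 ?(ltW zp0)//=.
    by rewrite ler_piMr ?hat_le1// oppr_ge0 ltW.
  + by move=> t /hat0 ->; rewrite oppr0.
- apply: (@radial_nonneg_bump _ _ _ _ _ (anchor T n k) (mesh T n) (z (anchor T n k))) => //.
  + move=> t t0T /(stable t t0T) zt.
    by apply: Kptw_gt0 (zK t t0T) => //; rewrite -(pmulr_lgt0 _ zp0).
  + move=> t; rewrite mulr_ge0 ?anchored_hat_ge0 ?(ltW zp0)//=.
    by rewrite ler_piMr ?hat_le1// ltW.
Qed.

(** All four requirements are stable under sums, and each term meets them. *)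
Lemma hat_approx_Krad_crit (T r : R) (y u z : R -> R) n : 0 < T -> 0 < r ->
  {within `[0, T], continuous y} ->
  (forall t, 0 <= t <= T -> Zset r (y t)) ->
  (forall t, 0 <= t <= T -> Kptw T r y u t (z t)) -> z 0 = 0 ->
  Krad_crit T r y u (hat_approx T z n).
Proof.
move=> T0 r0 cy yZ zK z0; split.
- exists (hat_approx T z n) => // m x.
  exact/smooth_derivable1n/smooth_hat_approx.
- move=> t t0T; rewrite /hat_approx; elim/big_ind: _ => [|a b|k _].
  + exact/Kptw0/yZ.
  + exact: KptwD.
  + have [->|term0] := eqVneq (anchor_coef T z n k * anchored_hat T n k t) 0.
      exact/Kptw0/yZ.
    apply: Kptw_sign (zK t t0T).
    have hat0 : 0 < anchored_hat T n k t.
      rewrite lt_neqAle anchored_hat_ge0 andbT eq_sym.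
      by apply: contra_neq term0 => ->; rewrite mulr0.
    by rewrite mulrA mulr_gt0// hat_term_sign.
- apply: big1 => k _; apply/eqP; apply: contraT.
  by move=> /(hat_term_sign _); rewrite z0 mul0r ltxx => -> //; rewrite lexx ltW.
- apply: (@fun_sum_ind (radial T r y) n.+2
    (fun k t => anchor_coef T z n k * anchored_hat T n k t));
    [exact: radial0|exact: radialD|move=> k].
  by apply: (radial_hat_term (u := u)) => //; rewrite -ltnS.
Qed.

End critical_approximation.

Lemma le_supnorm (R : realType) (T M : R) (v : R -> R) : 0 <= T ->
  (forall t, 0 <= t <= T -> `|v t| <= M) -> supnorm T v <= M.
Proof.
move=> T0 vM; apply: ge_sup.
  by exists `|v 0|, 0 => //=; rewrite in_itv/= lexx.
by move=> _ [t /= t0T <-]; apply: vM; rewrite in_itv in t0T.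
Qed.

Lemma regulated_le_supnorm (R : realType) (T : R) (v : R -> R) t :
  regulated T v -> 0 <= t <= T -> `|v t| <= supnorm T v.
Proof.
move=> /regulated_bounded[M vM] t0T; apply: ub_le_sup.
  by exists M => _ [s /= s0T <-]; apply: vM; rewrite in_itv in s0T.
by exists t; rewrite //= in_itv.
Qed.

Theorem theorem6p5 (R : realType) (T r y0 : R) (u y z : R -> R)
    (T_gt0 : 0 < T) (r_gt0 : 0 < r) (y0_in_Z : Zset r y0)
    (u_CBV : CBV T u) (y_stop : is_stop T r y0 u y)
    (z_red : Kred_crit T r y u z) :
  exists (zij : nat -> nat -> R -> R) (zj : nat -> R -> R),
    [/\ (forall i j, Gr T (zij i j)) /\ (forall j, Gr T (zj j)),
        forall i j, Krad_crit T r y u (zij i j) /\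
                    supnorm T (zij i j) <= supnorm T z,
        forall j, Kred_crit T r y u (zj j) /\
                  supnorm T (zj j) <= supnorm T z,
        forall j t, 0 <= t <= T -> zij i j t @[i --> \oo] --> zj j t
      & {uniform `[0, T], zj @ \oo --> z}].
Proof.
have [[_ y_cont] _ y_Z _] := y_stop.
have [[z_reg z_rc] z_K z0 _] := z_red.
exists (fun i _ => hat_approx T z i), (fun=> z); split.
- by split=> // i _; exact/smooth_Gr/smooth_hat_approx.
- move=> i _; split; first exact: hat_approx_Krad_crit.
  apply: le_supnorm (ltW T_gt0) _ => t t0T.
  by apply: hat_approx_le => // s; exact: regulated_le_supnorm.
- by [].
- move=> _ t t0T; apply: hat_approx_cvg => // zt0.
  exact: Kred_crit_continuous z_red t0T zt0.
- apply/uniform_segmentP => e e0; near=> n => t _.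
  by rewrite subrr normr0.
Unshelve. all: by end_near. Qed.
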